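(* Let $s>1$ and $0<c_1<\tfrac12<c_2<1$. Let $H_N$ be the measure on $[0,1]$ with no atoms whose density $h_N$ is the Nadarajah logistic density supported on $(c_1,c_2)$: $h_N(\omega)=0$ for $0<\omega<c_1$ and for $c_2<\omega<1$, and for $\omega\in(c_1,c_2)$ $$h_N(\omega)=(s-1)(c_2-c_1)\bigl[(2c_2-1)(1-2c_1)\bigr]^s[(\omega-c_1)(c_2-\omega)]^{s-2}\bigl[(2c_2-1)^s(\omega-c_1)^s+(1-2c_1)^s(c_2-\omega)^s\bigr]^{\frac1s-2}.$$ Let $A_N$ be the corresponding dependence function, $$A_N(\omega)=\int_0^1\max\{(1-\omega)q,\ \omega(1-q)\}\,dH_N(q),\qquad 0\le\omega\le1 .$$ Then $$A_N(\omega)=\begin{cases}1-\omega & \text{if } 0\le\omega<c_1,\\[4pt] \frac{(1-c_2)(\omega-c_1)}{c_2-c_1}+\frac{c_1(c_2-\omega)}{c_2-c_1}+W(\omega) & \text{if } c_1\le\omega\le c_2,\\[4pt] \omega & \text{if } c_2<\omega\le1,\end{cases}$$ where $$W(\omega)=\frac{1}{c_2-c_1}\bigl[(2c_2-1)^s(\omega-c_1)^s+(1-2c_1)^s(c_2-\omega)^s\bigr]^{\frac1s}.$$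
   Context: The Nadarajah logistic density on $(a,b)\subset[0,1]$, with $0\le a<\frac12<b\le1$, $\alpha=2b-1$, $\beta=1-2a$, $s>1$ and no atoms at $a$ or $b$, is $$h_N(\omega)=(s-1)(b-a)(\alpha\beta)^s[(\omega-a)(b-\omega)]^{s-2}[\alpha^s(\omega-a)^s+\beta^s(b-\omega)^s]^{\frac1s-2},\quad \omega\in(a,b),$$ and $h_N=0$ outside $(a,b)$. Here $a=c_1$, $b=c_2$. Dependence functions refer to a bivariate extreme value pair $(X,Y)$ for minima with exponential margins: $\Pr(X>x,Y>y)=\exp\{-\int_0^1\max[\omega x,(1-\omega)y]\,dH_N(\omega)\}$. *)

(* Defs.v *)
From HB Require Import structures.
From mathcomp Require Import all_boot all_order all_algebra.
From mathcomp Require Import all_classical all_reals all_analysis.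
From mathcomp Require Import measurable_realfun charge.

Set Implicit Arguments.
Unset Strict Implicit.
Unset Printing Implicit Defensive.

Import Order.TTheory GRing.Theory Num.Theory.
Import numFieldNormedType.Exports.

Local Open Scope classical_set_scope.
Local Open Scope ring_scope.

Section nadarajah.
Context {R : realType}.

Definition nadarajah_density (c1 c2 s w : R) : R :=
  if c1 < w < c2 then
    (s - 1) * (c2 - c1) * ((2 * c2 - 1) * (1 - 2 * c1)) `^ s
    * ((w - c1) * (c2 - w)) `^ (s - 2)
    * ((2 * c2 - 1) `^ s * (w - c1) `^ s + (1 - 2 * c1) `^ s * (c2 - w) `^ s)
      `^ (1 / s - 2)
  else 0.

Lemma nadarajah_density_ge0 c1 c2 s w :
  1 < s -> 0 <= nadarajah_density c1 c2 s w.
Proof.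
move=> s1; rewrite /nadarajah_density; case: ifP => // /andP[c1w wc2].
by rewrite !mulr_ge0 ?powR_ge0// subr_ge0 ltW// (lt_trans c1w).
Qed.

Lemma measurable_nadarajah_density c1 c2 s :
  measurable_fun [set: measurableTypeR R] (nadarajah_density c1 c2 s).
Proof.
rewrite /nadarajah_density; apply: measurable_fun_ifT => //.
  by apply: measurable_and; exact: measurable_fun_ltr.
apply: measurable_funM; last first.
  apply: (measurableT_comp (measurable_powR _)).
  by apply: measurable_funD; apply: measurable_funM => //;
    apply: (measurableT_comp (measurable_powR _)); exact: measurable_funB.
apply: measurable_funM => //; apply: (measurableT_comp (measurable_powR _)).
by apply: measurable_funM; exact: measurable_funB.
Qed.

(* The measure with density [nadarajah_density] and no atoms. It lives on [R],
   but is carried by ]c1, c2[, hence by [0, 1] when 0 <= c1 and c2 <= 1. The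
   proof that 1 < s ensures that the density is nonnegative. *)
Definition nadarajah_measure (c1 c2 s : R) (s_gt1 : 1 < s)
    (V : set (measurableTypeR R)) : \bar R :=
  (\int[lebesgue_measure]_(q in V) (nadarajah_density c1 c2 s q)%:E)%E.

Section nadarajah_measure_isMeasure.
Variables (c1 c2 s : R) (s_gt1 : 1 < s).

Let mu0 : nadarajah_measure c1 c2 s_gt1 set0 = 0%E.
Proof. exact: integral_set0. Qed.

Let mu_ge0 V : (0 <= nadarajah_measure c1 c2 s_gt1 V)%E.
Proof.
by apply: integral_ge0 => x _; rewrite lee_fin nadarajah_density_ge0.
Qed.

Let mu_semi_sigma_additive :
  semi_sigma_additive (nadarajah_measure c1 c2 s_gt1).
Proof.
apply: semi_sigma_additive_nng_induced.
  by apply/measurable_EFinP; exact: measurable_nadarajah_density.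
by move=> x; rewrite lee_fin nadarajah_density_ge0.
Qed.

HB.instance Definition _ := isMeasure.Build _ _ _
  (nadarajah_measure c1 c2 s_gt1) mu0 mu_ge0 mu_semi_sigma_additive.

End nadarajah_measure_isMeasure.

Definition dependence_function
    (H : {measure set (measurableTypeR R) -> \bar R}) (w : R) : \bar R :=
  (\int[H]_(q in `[0%R, 1%R]) (Num.max ((1 - w) * q) (w * (1 - q)))%:E)%E.

Definition nadarajah_W (c1 c2 s w : R) : R :=
  1 / (c2 - c1) *
  ((2 * c2 - 1) `^ s * (w - c1) `^ s + (1 - 2 * c1) `^ s * (c2 - w) `^ s)
    `^ (1 / s).

End nadarajah.

(* Main.v *)
Require Import Defs.
From mathcomp Require Import all_boot all_order all_algebra.
From mathcomp Require Import all_classical all_reals all_analysis.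
From mathcomp Require Import measurable_realfun ring lra.

(** The density is, up to the factor [b - a], the second derivative of a norm.
    With [a = c1], [b = c2], [A = (2 * b - 1) `^ s] and [B = (1 - 2 * a) `^ s],
    put [N q = (A * (q - a) `^ s + B * (b - q) `^ s) `^ (1 / s)].  This is a
    weighted [s]-norm of the pair [(q - a, b - q)], whose coordinates have the
    constant sum [b - a]; that constancy is what turns the square of the sum
    into a constant in the formula for [N''], and gives
    [N'' = (b - a) * nadarajah_density] on [`]a, b[] ([is_derive_dwnorm],
    [nadarajah_densityE]).  In the same way [nadarajah_W = N / (b - a)].

    For an affine function [q |-> k + l * q], the function
    [(k + l * q) * N' q - l * N q] is therefore a primitive of
    [(k + l * q) * N'' q].  Its value is known at both ends, since [N] and [N']
    extend continuously to [a] and [b] ([integral_affine_d2wnorm] and the four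
    lemmas on endpoint values).

    The kernel [Num.max ((1 - w) * q) (w * (1 - q))] is [w * (1 - q)] for
    [q <= w] and [(1 - w) * q] for [w <= q].  Let [m] be the point of [[a, b]]
    nearest to [w].  On [`]a, m[] and on [`]m, b[] the kernel is affine, so the
    two integrals add up to a single closed formula in [w] and [m]
    ([dependence_function_clamp]):
    [(b - a) * A_N w = N m + (w - m) * N' m
      + w * (1 - b) * (1 - 2 * a) + (1 - w) * a * (2 * b - 1)].
    Thus [A_N] is the sum of an affine function and of [N / (b - a)] continued
    by its tangents at the endpoints, and the three cases of the theorem are
    [m = a], [m = w] and [m = b].

    If [s < 2] the density blows up at [a] and [b], so the fundamental theorem
    of calculus on closed intervals does not apply directly; [ge0_FTC2_oo]
    reaches the open interval by exhaustion. *)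

Import Order.TTheory GRing.Theory Num.Theory.
Import numFieldNormedType.Exports.
Local Open Scope classical_set_scope.
Local Open Scope ring_scope.

(** * Integration *)

Import HBNNSimple.

(** Both sides agree on indicator functions by hypothesis, hence on simple
    functions by linearity, hence on [f] by monotone convergence along simple
    functions increasing to [f]. *)
Lemma ge0_integral_density d (T : measurableType d) (R : realType)
    (mu nu : {measure set T -> \bar R}) (h : T -> R) :
  measurable_fun setT h -> (forall x, 0 <= h x) ->
  (forall V, measurable V -> nu V = (\int[mu]_(x in V) (h x)%:E)%E) ->
  forall (E : set T) (f : T -> \bar R), measurable E -> measurable_fun E f ->
  (forall x, E x -> (0 <= f x)%E) ->
  (\int[nu]_(x in E) f x = \int[mu]_(x in E) (f x * (h x)%:E))%E.
Proof.
move=> mh h0 nuE E f mE mf f0.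
have mhE : measurable_fun E (EFin \o h).
  by apply/measurable_EFinP; exact: measurable_funTS.
pose g := nnsfun_approx mE mf.
have mg n : measurable_fun E (EFin \o g n).
  by apply/measurable_EFinP; exact/measurable_funTS/measurable_funP.
have cvgg x : E x -> (g n x)%:E @[n --> \oo] --> f x.
  by move=> Ex; exact: cvg_nnsfun_approx.
have ndg x m n : (m <= n)%N -> (g m x <= g n x)%R.
  by move=> mn; exact/lefP/nd_nnsfun_approx.
transitivity (limn (fun n => \int[nu]_(x in E) (g n x)%:E)%E).
  rewrite -monotone_convergence//.
  - by apply: eq_integral => x /[!inE] Ex; exact/esym/cvg_lim/cvgg.
  - by move=> n x Ex; rewrite lee_fin.
  - by move=> x Ex m n mn; rewrite lee_fin ndg.
transitivity (limn (fun n =>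
    \int[mu]_(x in E) ((g n x)%:E * (h x)%:E))%E); last first.
  rewrite -monotone_convergence//.
  - apply: eq_integral => x /[!inE] Ex; apply/cvg_lim => //.
    by apply: cvgeZr => //; exact: cvgg.
  - move=> n; exact: (emeasurable_funM (mg n) mhE).
  - by move=> n x Ex; rewrite mule_ge0// lee_fin.
  - by move=> x Ex m n mn; rewrite lee_wpmul2r ?lee_fin// ndg.
congr (limn _); apply/funext => n.
have mind y :
    measurable_fun E (fun x => (\1_(g n @^-1` [set y]) x)%:E : \bar R).
  by apply/measurable_EFinP; exact: measurable_indic.
have mindh y : measurable_fun E
    (fun x => (\1_(g n @^-1` [set y]) x)%:E * (h x)%:E)%E.
  exact: (emeasurable_funM (mind y) mhE).
have ind_ge0 x y : (0 <= y%:E * (\1_(g n @^-1` [set y]) x)%:E)%E.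
  by rewrite -EFinM nnfun_muleindic_ge0.
have gE x : (g n x)%:E =
    (\sum_(y \in range (g n)) (y%:E * (\1_(g n @^-1` [set y]) x)%:E))%E.
  by rewrite (fimfunE (g n)) -fsumEFin.
under eq_integral do rewrite gE.
rewrite ge0_integral_fsum//; last by move=> y; exact: emeasurable_funM.
under [RHS]eq_integral.
  move=> x _; rewrite gE ge0_mule_fsuml//.
  over.
rewrite ge0_integral_fsum//; last 2 first.
- by move=> y; do 2 apply: emeasurable_funM => //.
- by move=> y x Ex; rewrite mule_ge0// lee_fin.
apply: eq_fsbigr => y /[!inE] -[x0 _ <-].
under [RHS]eq_integral do rewrite -muleA.
rewrite !ge0_integralZl ?lee_fin//; last first.
- by move=> x Ex; rewrite mule_ge0// lee_fin.
congr *%E.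
rewrite integral_indic// nuE; last exact: measurableI.
rewrite setIC integral_mkcondr; apply: eq_integral => x _.
by rewrite epatch_indic muleC.
Qed.

(** The integrand may be unbounded near [a] and [b]: the theorem for continuous
    functions on closed intervals is applied to intervals increasing to
    [`]a, b[], and nonnegativity gives convergence of the integrals. *)
Lemma ge0_FTC2_oo (R : realType) (f F : R -> R) (a b : R) : a <= b ->
  {in `]a, b[, forall x, 0 <= f x} ->
  {in `]a, b[, continuous f} ->
  (forall x, x \in `]a, b[ -> is_derive x (1 : R) F (f x)) ->
  {for a, continuous F} -> {for b, continuous F} ->
  (\int[lebesgue_measure]_(x in `]a, b[) (f x)%:E = (F b - F a)%:E)%E.
Proof.
rewrite le_eqVlt => /predU1P[->|ab f0 cf dF cFa cFb].
  by move=> *; rewrite set_itvoo0// integral_set0 subrr.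
(* The factor 1 / 3 keeps [a + e n < b - e n] for all [n], also [n = 0]. *)
pose e n : R := (b - a) / 3 * harmonic n.
have e_gt0 n : 0 < e n.
  by apply: mulr_gt0; [rewrite divr_gt0// subr_gt0|exact: harmonic_gt0].
have e_cvg0 : e n @[n --> \oo] --> 0.
  rewrite -[X in _ --> X](mulr0 ((b - a) / 3)).
  by apply: cvgM; [exact: cvg_cst|exact: cvg_harmonic].
have e_ni m n : (m <= n)%N -> e n <= e m.
  move=> mn; rewrite ler_wpM2l ?divr_ge0 ?subr_ge0 ?(ltW ab)//=.
  by rewrite lef_pV2 ?posrE// ler_nat.
have e_lt n : a + e n < b - e n.
  have : e n <= (b - a) / 3.
    rewrite ler_piMr ?divr_ge0 ?subr_ge0 ?(ltW ab)//=.
    by rewrite invf_le1// ler1n.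
  lra.
pose I n := `[a + e n, b - e n]%classic.
have I_oo n x : x \in `[a + e n, b - e n] -> x \in `]a, b[.
  by rewrite !in_itv/= => /andP[? ?]; have ? := e_gt0 n; apply/andP; split; lra.
have IU : `]a, b[%classic = \bigcup_n I n.
  apply/seteqP; split => x /=; last by move=> [n _]; exact: I_oo.
  rewrite in_itv/= => /andP[ax xb].
  have [N _ HN] : \forall n \near \oo, e n < Num.min (x - a) (b - x).
    apply: (cvgr_lt _ e_cvg0); rewrite lt_min; apply/andP; split; lra.
  exists N => //; rewrite /I/= in_itv/=; have := HN N (leqnn _).
  by rewrite lt_min => /andP[? ?]; apply/andP; split; lra.
have FI n : (\int[lebesgue_measure]_(x in I n) (f x)%:E =
    (F (b - e n) - F (a + e n))%:E)%E.
  have cont x : x \in `[a + e n, b - e n] -> {for x, continuous F}.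
    move=> /I_oo/dF[dFx _].
    by apply/differentiable_continuous/derivable1_diffP.
  have := e_lt n => ltn.
  rewrite (continuous_FTC2 (F := F))//.
  - by apply: continuous_in_subspaceT => x /[!inE]/= /I_oo; exact: cf.
  - split.
    + move=> x xI; have : x \in `[a + e n, b - e n].
        by apply: subset_itv_oo_cc xI.
      by move=> /I_oo/dF[].
    + by apply: cvg_at_right_filter; apply: cont; rewrite in_itv/= lexx ltW.
    + by apply: cvg_at_left_filter; apply: cont; rewrite in_itv/= lexx ltW.
  - move=> x xI; have : x \in `[a + e n, b - e n].
      by apply: subset_itv_oo_cc xI.
    by move=> /I_oo/dF[_ <-]; rewrite derive1E.
rewrite IU.
have lim1 : (\int[lebesgue_measure]_(x in I n) (f x)%:E @[n --> \oo] -->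
    \int[lebesgue_measure]_(x in \bigcup_n I n) (f x)%:E)%E.
  apply: ge0_nondecreasing_set_cvg_integral => //.
  - move=> m n mn; rewrite subsetEset => x; rewrite /I/= !in_itv/= => /andP[? ?].
    by have ? := e_ni _ _ mn; apply/andP; split; lra.
  - by move=> n; exact: measurable_itv.
  - move=> n; apply/measurable_EFinP.
    apply: subspace_continuous_measurable_fun; first exact: measurable_itv.
    by apply: continuous_in_subspaceT => x /[!inE]/= /I_oo; exact: cf.
  - by move=> n x /I_oo; rewrite lee_fin; exact: f0.
suff lim2 : (\int[lebesgue_measure]_(x in I n) (f x)%:E @[n --> \oo] -->
    (F b - F a)%:E)%E by exact: (cvg_unique _ lim1 lim2).
rewrite (funext FI); apply: cvg_EFin; first exact: nearW.
have be : b - e n @[n --> \oo] --> b.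
  by rewrite -[X in _ --> X]subr0; apply: cvgB => //; exact: cvg_cst.
have ae : a + e n @[n --> \oo] --> a.
  by rewrite -[X in _ --> X]addr0; apply: cvgD => //; exact: cvg_cst.
by apply: cvgB; [exact: (cvg_comp _ _ be cFb)|exact: (cvg_comp _ _ ae cFa)].
Qed.

(** The point [m] has measure zero; it is allowed to be an endpoint, in which
    case one of the two intervals is empty. *)
Lemma ge0_integral_oo_split (R : realType) (f : R -> \bar R) (a m b : R) :
  a <= m -> m <= b -> measurable_fun `]a, b[ f ->
  (forall x, x \in `]a, b[ -> (0 <= f x)%E) ->
  (\int[lebesgue_measure]_(x in `]a, b[) f x =
   \int[lebesgue_measure]_(x in `]a, m[) f x +
   \int[lebesgue_measure]_(x in `]m, b[) f x)%E.
Proof.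
move=> + + mf f0.
rewrite le_eqVlt => /predU1P[<- _|am].
  by rewrite set_itvoo0// integral_set0 add0e.
rewrite le_eqVlt => /predU1P[->|mb].
  by rewrite (set_itvoo0 b) integral_set0 adde0.
have abE : `]a, b[%classic = `]a, m[%classic `|` `[m, b[%classic.
  by apply: itv_bndbnd_setU; rewrite bnd_simp// ltW.
have mfm : measurable_fun `[m, b[ f.
  by apply: measurable_funS mf => //; rewrite abE; exact: subsetUr.
have mfU : measurable_fun (`]a, m[ `|` `[m, b[) f by rewrite -abE.
rewrite abE ge0_integral_setU//.
- congr (_ + _)%E; rewrite -integral_itv_obnd_cbnd//.
  by apply: measurable_funS mfm => //; apply: subset_itvr; rewrite bnd_simp.
- move=> x amb; apply: f0.
  by have : `]a, b[%classic x by rewrite abE.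
- apply/disj_setPS => x [] /=; rewrite !in_itv/= => /andP[_ xm] /andP[mx _].
  by have := lt_le_trans xm mx; rewrite ltxx.
Qed.

(** * Powers of the distance to an endpoint *)

(** By convention [x `^ p = 1] for [x < 0], so that [x |-> x `^ p] has a jump
    at [0].  The absolute value removes it, which gives functions that are
    continuous on the whole line and need no one-sided limits at the endpoints
    of the support. *)
Lemma continuous_normr_powR (R : realType) (p : R) : 0 < p ->
  continuous (fun x : R => `|x| `^ p).
Proof.
move=> p0 x; have [->|x0] := eqVneq x 0; last first.
  apply: (@continuous_comp _ _ _ (@Num.norm R R) (fun y => y `^ p)).
    exact: norm_continuous.
  apply/differentiable_continuous/derivable1_diffP.
  by apply: derivable_powR; rewrite in_itv/= andbT normr_gt0.
apply/cvgrPdist_lt => /= e e0; near=> y.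
rewrite normr0 powR0 ?gt_eqF// sub0r normrN ger0_norm ?powR_ge0//.
have -> : e = (e `^ p^-1) `^ p by rewrite -powRrM mulVf ?gt_eqF// powRr1// ltW.
rewrite gt0_ltr_powR// ?nnegrE ?powR_ge0//.
near: y. apply: (@nbhs0_lt R R); exact: powR_gt0.
Unshelve. all: by end_near. Qed.

Lemma powR_root (R : realType) (x p : R) : 0 < x -> p != 0 ->
  (x `^ p) `^ (1 / p) = x.
Proof. by move=> x0 p0; rewrite -powRrM mulrCA divff// mulr1 powRr1// ltW. Qed.

Lemma is_derive_powR_subr (R : realType) (p a x : R) : a < x ->
  is_derive x (1 : R) (fun q => `|q - a| `^ p) (p * `|x - a| `^ (p - 1)).
Proof.
move=> ax; have xa : 0 < x - a by rewrite subr_gt0.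
have dg : is_derive x (1 : R) (fun q => q - a) 1.
  by apply: is_derive_eq; rewrite subr0.
have df := @is_derive1_comp _ (fun y => y `^ p) (fun q => q - a) _ _ _
  (is_derive1_powR p xa) dg.
rewrite gtr0_norm// -[X in is_derive _ _ _ X]mulr1.
apply: near_eq_is_derive df; near=> q; rewrite /= ger0_norm// subr_ge0 ltW//.
by near: q; exact: lt_nbhsr.
Unshelve. all: by end_near. Qed.

Lemma is_derive_powR_rsub (R : realType) (p b x : R) : x < b ->
  is_derive x (1 : R) (fun q => `|b - q| `^ p) (- (p * `|b - x| `^ (p - 1))).
Proof.
move=> xb; have bx : 0 < b - x by rewrite subr_gt0.
have dg : is_derive x (1 : R) (fun q => b - q) (-1).
  by apply: is_derive_eq; rewrite add0r mul1r.
have df := @is_derive1_comp _ (fun y => y `^ p) (fun q => b - q) _ _ _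
  (is_derive1_powR p bx) dg.
rewrite gtr0_norm// -[X in is_derive _ _ _ X]mulrN1.
apply: near_eq_is_derive df; near=> q; rewrite /= ger0_norm// subr_ge0 ltW//.
by near: q; exact: lt_nbhsl.
Unshelve. all: by end_near. Qed.

(** * The weighted norm and its derivatives *)

Section weighted_norm.
Context {R : realType}.
Variables (s a b A B : R).
Hypotheses (s_gt1 : 1 < s) (ltab : a < b) (A_gt0 : 0 < A) (B_gt0 : 0 < B).

Definition wsum q := A * `|q - a| `^ s + B * `|b - q| `^ s.

Definition wnorm q := wsum q `^ (1 / s).

Definition dwnorm q :=
  wsum q `^ (1 / s - 1) *
  (A * `|q - a| `^ (s - 1) - B * `|b - q| `^ (s - 1)).

(** The factor [(b - a) ^+ 2] is the square of the sum of the distances of [q]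
    to [a] and to [b], for [a < q < b]. *)
Definition d2wnorm q :=
  (s - 1) * (b - a) ^+ 2 * (A * B) * ((q - a) * (b - q)) `^ (s - 2)
  * wsum q `^ (1 / s - 2).

Let s_gt0 : 0 < s. Proof. exact: lt_trans s_gt1. Qed.

(** The two distances cannot vanish together. *)
Lemma wsum_gt0 q : 0 < wsum q.
Proof.
have [->|qa] := eqVneq q a.
  rewrite ltr_wpDl ?mulr_ge0 ?powR_ge0 ?ltW// mulr_gt0// powR_gt0// normr_gt0.
  by rewrite subr_eq0 gt_eqF.
rewrite ltr_wpDr ?mulr_ge0 ?powR_ge0 ?(ltW B_gt0)// mulr_gt0// powR_gt0//.
by rewrite normr_gt0 subr_eq0.
Qed.

Let continuous_left p : 0 < p -> continuous (fun q => `|q - a| `^ p).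
Proof.
move=> p0 q; apply: (@continuous_comp _ _ _ (fun q => q - a)
    (fun y => `|y| `^ p)).
  by apply: cvgB; [exact: cvg_id|exact: cvg_cst].
exact: continuous_normr_powR.
Qed.

Let continuous_right p : 0 < p -> continuous (fun q => `|b - q| `^ p).
Proof.
move=> p0 q; apply: (@continuous_comp _ _ _ (fun q => b - q)
    (fun y => `|y| `^ p)).
  by apply: cvgB; [exact: cvg_cst|exact: cvg_id].
exact: continuous_normr_powR.
Qed.

Let continuous_wsum : continuous wsum.
Proof.
move=> q; apply: cvgD; apply: cvgM; do ?exact: cvg_cst.
- exact: continuous_left.
- exact: continuous_right.
Qed.

Let continuous_wsum_powR p : continuous (fun q => wsum q `^ p).
Proof.
move=> q; apply: (@continuous_comp _ _ _ wsum (fun y => y `^ p)).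
  exact: continuous_wsum.
apply/differentiable_continuous/derivable1_diffP.
exact/ex_derive/is_derive1_powR/wsum_gt0.
Qed.

Lemma continuous_wnorm : continuous wnorm.
Proof. exact: continuous_wsum_powR. Qed.

Lemma continuous_dwnorm : continuous dwnorm.
Proof.
have s1 : 0 < s - 1 by rewrite subr_gt0.
move=> q; apply: cvgM; first exact: continuous_wsum_powR.
apply: cvgB; apply: cvgM; do ?exact: cvg_cst.
- exact: continuous_left.
- exact: continuous_right.
Qed.

Lemma continuous_d2wnorm : {in `]a, b[, continuous d2wnorm}.
Proof.
move=> q; rewrite in_itv/= => /andP[aq qb].
apply: cvgM; last exact: continuous_wsum_powR.
apply: cvgM; first exact: cvg_cst.
apply: (@continuous_comp _ _ _ (fun q => (q - a) * (b - q))
  (fun y => y `^ (s - 2))).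
  by apply: cvgM; apply: cvgB; do ?[exact: cvg_cst|exact: cvg_id].
apply/differentiable_continuous/derivable1_diffP.
by apply: derivable_powR; rewrite in_itv/= andbT mulr_gt0 ?subr_gt0.
Qed.

Lemma d2wnorm_ge0 : {in `]a, b[, forall q, 0 <= d2wnorm q}.
Proof.
move=> q _; rewrite /d2wnorm !mulr_ge0 ?powR_ge0 ?(ltW A_gt0) ?(ltW B_gt0)//.
all: by rewrite subr_ge0 ltW.
Qed.

Let is_derive_wsum_powR p q : q \in `]a, b[ ->
  is_derive q (1 : R) (fun q => wsum q `^ p)
    (p * wsum q `^ (p - 1) *
     (s * (A * `|q - a| `^ (s - 1) - B * `|b - q| `^ (s - 1)))).
Proof.
rewrite in_itv/= => /andP[aq qb].
apply: (@is_derive1_comp _ (fun y => y `^ p) wsum).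
  exact/is_derive1_powR/wsum_gt0.
have dl := is_derive_powR_subr _ s _ _ aq.
have dr := is_derive_powR_rsub _ s _ _ qb.
by apply: is_derive_eq; rewrite /GRing.scale/=; ring.
Qed.

Lemma is_derive_wnorm q : q \in `]a, b[ ->
  is_derive q (1 : R) wnorm (dwnorm q).
Proof.
move=> /(is_derive_wsum_powR (1 / s)) D; apply: (is_derive_eq D).
by rewrite /dwnorm; field; rewrite gt_eqF.
Qed.

(** Write [u = q - a], [v = b - q], [U = u `^ (s - 2)], [V = v `^ (s - 2)] and
    [D = A * u ^+ 2 * U + B * v ^+ 2 * V], which is [wsum q].  Up to the factor
    [(s - 1) * D `^ (1 / s - 2)] the derivative is
    [D * (A * U + B * V) - (A * u * U - B * v * V) ^+ 2], and this equals
    [A * B * U * V * (u + v) ^+ 2] with [u + v = b - a]. *)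
Lemma is_derive_dwnorm q : q \in `]a, b[ ->
  is_derive q (1 : R) dwnorm (d2wnorm q).
Proof.
move=> qab; have D := is_derive_wsum_powR (1 / s - 1) _ qab.
move: qab; rewrite in_itv/= => /andP[aq qb].
have dl := is_derive_powR_subr _ (s - 1) _ _ aq.
have dr := is_derive_powR_rsub _ (s - 1) _ _ qb.
apply: is_derive_eq.
have u0 : 0 < q - a by rewrite subr_gt0.
have v0 : 0 < b - q by rewrite subr_gt0.
rewrite /d2wnorm /GRing.scale/= powRM ?ltW//.
(* All powers are expressed through the exponents [s - 2] and [1 / s - 2]. *)
have subr11 (r : R) : r - 1 - 1 = r - 2 by ring.
rewrite !subr11.
have powRB1E x r : 0 < x -> x `^ (r - 1) = x * x `^ (r - 2).
  move=> x0; have -> : r - 1 = 1 + (r - 2) by ring.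
  by rewrite powRD ?(gt_eqF x0) ?implybT// powRr1 // ltW.
have powRE x : 0 < x -> x `^ s = x * (x * x `^ (s - 2)).
  by move=> x0; rewrite -powRB1E// mulr_powRB1// ltW.
rewrite !powRB1E ?wsum_gt0 ?normr_gt0 ?gt_eqF//.
set E := wsum q `^ _.
rewrite /wsum !gtr0_norm// !powRE//.
by field; rewrite gt_eqF.
Qed.

(** The derivative of [(k + l * q) * dwnorm q - l * wnorm q] is
    [(k + l * q) * d2wnorm q], because the terms [l * dwnorm q] cancel. *)
Lemma integral_affine_d2wnorm k l x y : a <= x -> x <= y -> y <= b ->
  {in `]x, y[, forall q, 0 <= k + l * q} ->
  (\int[lebesgue_measure]_(q in `]x, y[) ((k + l * q) * d2wnorm q)%:E =
   ((k + l * y) * dwnorm y - l * wnorm y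
    - ((k + l * x) * dwnorm x - l * wnorm x))%:E)%E.
Proof.
move=> ax xy yb kl0.
have xyab q : q \in `]x, y[ -> q \in `]a, b[.
  by rewrite !in_itv/= => /andP[? ?]; apply/andP; split; lra.
have caff : continuous (fun q => k + l * q).
  move=> q; apply: cvgD; first exact: cvg_cst.
  by apply: cvgM; [exact: cvg_cst|exact: cvg_id].
have cF : continuous (fun q => (k + l * q) * dwnorm q - l * wnorm q).
  move=> q; apply: cvgB.
    by apply: cvgM; [exact: caff|exact: continuous_dwnorm].
  by apply: cvgM; [exact: cvg_cst|exact: continuous_wnorm].
apply: (@ge0_FTC2_oo _ (fun q => (k + l * q) * d2wnorm q)
  (fun q => (k + l * q) * dwnorm q - l * wnorm q) _ _ xy).
- by move=> q qxy; rewrite mulr_ge0 ?kl0// d2wnorm_ge0// xyab.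
- move=> q /xyab qab; apply: cvgM; first exact: caff.
  exact: continuous_d2wnorm.
- move=> q /xyab qab; have dN := is_derive_wnorm _ qab.
  have dN' := is_derive_dwnorm _ qab.
  by apply: is_derive_eq; rewrite /GRing.scale/=; ring.
- exact: cF.
- exact: cF.
Qed.

Let wnorm_end C : 0 < C ->
  (C * (b - a) `^ s) `^ (1 / s) = C `^ (1 / s) * (b - a).
Proof.
move=> C0; have L0 : 0 < b - a by rewrite subr_gt0.
rewrite powRM ?powR_ge0 ?(ltW C0)// -powRrM mulrCA divff ?gt_eqF//.
by rewrite mulr1 powRr1// ltW.
Qed.

Let dwnorm_end C : 0 < C ->
  (C * (b - a) `^ s) `^ (1 / s - 1) * (C * (b - a) `^ (s - 1)) = C `^ (1 / s).
Proof.
move=> C0; have L0 : 0 < b - a by rewrite subr_gt0.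
rewrite powRM ?powR_ge0 ?(ltW C0)// -powRrM.
have -> : s * (1 / s - 1) = - (s - 1) by field; rewrite gt_eqF.
rewrite mulrACA [_ * C]mulrC mulr_powRB1 ?divr_gt0// ?(ltW C0)//.
by rewrite powRN mulVf ?mulr1// gt_eqF// powR_gt0.
Qed.

Let wsum_left : wsum a = B * (b - a) `^ s.
Proof.
by rewrite /wsum subrr normr0 powR0 ?gt_eqF// mulr0 add0r gtr0_norm// subr_gt0.
Qed.

Let wsum_right : wsum b = A * (b - a) `^ s.
Proof.
by rewrite /wsum subrr normr0 powR0 ?gt_eqF// mulr0 addr0 gtr0_norm// subr_gt0.
Qed.

Lemma wnorm_left : wnorm a = B `^ (1 / s) * (b - a).
Proof. by rewrite /wnorm wsum_left wnorm_end. Qed.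

Lemma wnorm_right : wnorm b = A `^ (1 / s) * (b - a).
Proof. by rewrite /wnorm wsum_right wnorm_end. Qed.

Lemma dwnorm_left : dwnorm a = - B `^ (1 / s).
Proof.
have s1 : s - 1 != 0 by rewrite subr_eq0 gt_eqF.
rewrite /dwnorm wsum_left subrr normr0 powR0// mulr0 sub0r.
rewrite gtr0_norm ?subr_gt0//.
by rewrite mulrN dwnorm_end.
Qed.

Lemma dwnorm_right : dwnorm b = A `^ (1 / s).
Proof.
have s1 : s - 1 != 0 by rewrite subr_eq0 gt_eqF.
rewrite /dwnorm wsum_right subrr normr0 powR0// mulr0 subr0.
rewrite gtr0_norm ?subr_gt0//.
by rewrite dwnorm_end.
Qed.

End weighted_norm.

(** * The dependence function *)

Section nadarajah_wnorm.
Context {R : realType}.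
Variables (s c1 c2 : R).
Hypotheses (s_gt1 : 1 < s) (c1_lt_half : c1 < 1 / 2) (c2_gt_half : 1 / 2 < c2).

Local Notation A := ((2 * c2 - 1) `^ s).
Local Notation B := ((1 - 2 * c1) `^ s).

Let alpha_gt0 : 0 < 2 * c2 - 1. Proof. by move: c1_lt_half c2_gt_half; lra. Qed.
Let beta_gt0 : 0 < 1 - 2 * c1. Proof. by move: c1_lt_half c2_gt_half; lra. Qed.
Let c12 : c1 < c2. Proof. by move: c1_lt_half c2_gt_half; lra. Qed.
Let A_gt0 : 0 < A. Proof. exact: powR_gt0. Qed.
Let B_gt0 : 0 < B. Proof. exact: powR_gt0. Qed.

Let s_neq0 : s != 0. Proof. by rewrite gt_eqF// (lt_trans ltr01). Qed.

Lemma nadarajah_densityE q : q \in `]c1, c2[ ->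
  nadarajah_density c1 c2 s q = d2wnorm s c1 c2 A B q / (c2 - c1).
Proof.
rewrite in_itv/= /nadarajah_density => /[dup] /andP[c1q qc2] ->.
rewrite /d2wnorm /wsum !gtr0_norm ?subr_gt0//.
rewrite (powRM _ (ltW alpha_gt0) (ltW beta_gt0)).
by field; rewrite subr_eq0 gt_eqF.
Qed.

Lemma nadarajah_WE q : c1 <= q <= c2 ->
  nadarajah_W c1 c2 s q = wnorm s c1 c2 A B q / (c2 - c1).
Proof.
move=> /andP[c1q qc2]; rewrite /nadarajah_W /wnorm /wsum !ger0_norm ?subr_ge0//.
by rewrite mul1r mulrC.
Qed.

(** The hypotheses on [m] say that it is the point of [[c1, c2]] nearest to [w],
    in the form in which the integration uses it: to the left of [m] the kernel
    is [w * (1 - q)], to the right of [m] it is [(1 - w) * q].  The terms in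
    [dwnorm m] combine to [w * (1 - m) - (1 - w) * m = w - m]. *)
Lemma dependence_function_clamp w m : 0 <= w <= 1 -> 0 < c1 -> c2 < 1 ->
  c1 <= m <= c2 ->
  {in `]c1, m[, forall q, q <= w} -> {in `]m, c2[, forall q, w <= q} ->
  dependence_function (nadarajah_measure c1 c2 s_gt1) w =
  (((w - m) * dwnorm s c1 c2 A B m + wnorm s c1 c2 A B m
    + w * (1 - c2) * (1 - 2 * c1) + (1 - w) * c1 * (2 * c2 - 1))
   / (c2 - c1))%:E.
Proof.
move=> /andP[w0 w1] c1_gt0 c2_lt1 /andP[c1m mc2] qw wq.
pose kern q := Num.max ((1 - w) * q) (w * (1 - q)).
have mkern : measurable_fun setT kern.
  apply: measurable_maxr; apply: measurable_funM => //.
  exact: measurable_funB.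
have mh := measurable_nadarajah_density c1 c2 s.
have kern_ge0 q : 0 <= q <= 1 -> 0 <= kern q.
  by move=> /andP[q0 q1]; rewrite le_max mulr_ge0// subr_ge0.
have oo01 q : q \in `]c1, c2[ -> 0 <= q <= 1.
  by rewrite in_itv/= => /andP[? ?]; apply/andP; split; lra.
rewrite /dependence_function.
rewrite (@ge0_integral_density _ _ _ lebesgue_measure _ _ mh)//; first last.
- by apply/measurable_EFinP; exact: measurable_funTS mkern.
- by move=> q; exact: nadarajah_density_ge0.
transitivity (\int[lebesgue_measure]_(q in `]c1, c2[)
    (kern q * nadarajah_density c1 c2 s q)%:E)%E.
  rewrite [LHS]integral_mkcond [RHS]integral_mkcond; apply: eq_integral => q _.
  rewrite !patchE; case: ifPn => [|/negP] q01; case: ifPn => [|/negP] q12 //.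
  - rewrite /nadarajah_density; case: ifPn => [cqc|]; last by rewrite mule0.
    by exfalso; apply: q12; rewrite inE/= in_itv.
  - by exfalso; apply: q01; move: q12; rewrite !inE/= => /oo01; rewrite in_itv.
rewrite (@ge0_integral_oo_split _ _ _ m)//; last 2 first.
- apply/measurable_EFinP; apply: measurable_funTS.
  exact: measurable_funM.
- by move=> q /oo01/kern_ge0 k0; rewrite lee_fin mulr_ge0// nadarajah_density_ge0.
have L0 : c2 - c1 != 0 by rewrite subr_eq0 gt_eqF.
have Li0 : 0 < (c2 - c1)^-1 by rewrite invr_gt0 subr_gt0.
have left_oo q : q \in `]c1, m[ -> q \in `]c1, c2[.
  by rewrite !in_itv/= => /andP[-> qm]; exact: lt_le_trans qm mc2.
have right_oo q : q \in `]m, c2[ -> q \in `]c1, c2[.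
  by rewrite !in_itv/= => /andP[mq ->]; rewrite (le_lt_trans c1m mq).
have -> : (\int[lebesgue_measure]_(q in `]c1, m[)
    (kern q * nadarajah_density c1 c2 s q)%:E =
  \int[lebesgue_measure]_(q in `]c1, m[)
    ((w / (c2 - c1) + (- (w / (c2 - c1))) * q) * d2wnorm s c1 c2 A B q)%:E)%E.
  apply: eq_integral => q; rewrite inE/= => qm.
  have kq : kern q = w * (1 - q) by apply/max_idPr; have := qw q qm; lra.
  by rewrite kq nadarajah_densityE ?left_oo//; congr _%:E; field.
have -> : (\int[lebesgue_measure]_(q in `]m, c2[)
    (kern q * nadarajah_density c1 c2 s q)%:E =
  \int[lebesgue_measure]_(q in `]m, c2[)
    ((0 + (1 - w) / (c2 - c1) * q) * d2wnorm s c1 c2 A B q)%:E)%E.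
  apply: eq_integral => q; rewrite inE/= => qm.
  have kq : kern q = (1 - w) * q by apply/max_idPl; have := wq q qm; lra.
  by rewrite kq nadarajah_densityE ?right_oo//; congr _%:E; field.
rewrite !integral_affine_d2wnorm//; last 2 first.
- move=> q /right_oo/oo01/andP[q0 q1].
  by rewrite add0r !mulr_ge0// ?subr_ge0// ltW.
- move=> q /left_oo/oo01/andP[q0 q1].
  rewrite (_ : _ + _ = w * (1 - q) / (c2 - c1)); last by field.
  by rewrite !mulr_ge0// ?subr_ge0// ltW.
rewrite -EFinD wnorm_left// wnorm_right// dwnorm_left// dwnorm_right//.
by rewrite !powR_root//; congr _%:E; field.
Qed.

End nadarajah_wnorm.

Theorem proposition6p3 (R : realType) (s c1 c2 : R) (s_gt1 : 1 < s)
    (c1_gt0 : 0 < c1) (c1_lt_half : c1 < 1 / 2)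
    (c2_gt_half : 1 / 2 < c2) (c2_lt1 : c2 < 1)
    (w : R) (w_ge0 : 0 <= w) (w_le1 : w <= 1) :
  dependence_function (nadarajah_measure c1 c2 s_gt1) w =
  (if w < c1 then 1 - w
   else if w <= c2 then
     (1 - c2) * (w - c1) / (c2 - c1) + c1 * (c2 - w) / (c2 - c1)
     + nadarajah_W c1 c2 s w
   else w)%:E.
Proof.
have c12 : c1 < c2 by lra.
have c12n0 : c2 - c1 != 0 by rewrite subr_eq0 gt_eqF.
have s_neq0 : s != 0 by rewrite gt_eqF// (lt_trans ltr01).
have alpha_gt0 : 0 < 2 * c2 - 1 by lra.
have beta_gt0 : 0 < 1 - 2 * c1 by lra.
have w01 : 0 <= w <= 1 by apply/andP.
have clampE := dependence_function_clamp _ _ _ s_gt1 c1_lt_half c2_gt_half _ _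
  w01 c1_gt0 c2_lt1.
have [wc1|c1w] := ltP w c1.
  rewrite (clampE c1); first last.
  - by move=> q; rewrite in_itv/= => /andP[? _]; lra.
  - by move=> q; rewrite in_itv/= => /andP[? ?]; lra.
  - by rewrite lexx ltW.
  rewrite dwnorm_left ?wnorm_left ?powR_gt0// powR_root//.
  by congr _%:E; field.
have [wc2|c2w] := leP w c2.
  rewrite (clampE w); first last.
  - by move=> q; rewrite in_itv/= => /andP[? _]; lra.
  - by move=> q; rewrite in_itv/= => /andP[? ?]; lra.
  - by rewrite c1w.
  rewrite nadarajah_WE//; last by rewrite c1w.
  by congr _%:E; field.
rewrite (clampE c2); first last.
- by move=> q; rewrite in_itv/= => /andP[? ?]; lra.
- by move=> q; rewrite in_itv/= => /andP[? ?]; lra.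
- by rewrite lexx ltW.
rewrite dwnorm_right ?wnorm_right ?powR_gt0// powR_root//.
by congr _%:E; field.
Qed.
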